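(* Let $q$ be a real number. The function $w\mapsto q^{\|w\|}$ on $\mathfrak{S}_\infty$ is positive definite if and only if $0\le q\le 1$.
   Context: $\mathfrak{S}_\infty$ is the group of finitely supported permutations of $\mathbb{N}=\{1,2,\dots\}$, viewed as a Coxeter group with the generating set $S$ of transpositions $(n,n+1)$, $n\in\mathbb{N}$. For $w\in\mathfrak{S}_\infty$ the colour-length $\|w\|$ is the number of distinct generators from $S$ occurring in a reduced word (word of minimal length in $S$) of $w$; it does not depend on the reduced word. A function $\varphi\colon\Gamma\to\mathbb{C}$ on a group $\Gamma$ is positive definite if $\sum_{x,y\in\Gamma}\varphi(y^{-1}x)\alpha(x)\overline{\alpha(y)}\ge 0$ for every finitely supported $\alpha\colon\Gamma\to\mathbb{C}$. Convention: $0^0=1$. *)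

(* Defs.v *)
From HB Require Import structures.
From mathcomp Require Import all_boot all_order all_algebra all_fingroup.
From mathcomp Require Import finmap.
From mathcomp Require Import mathcomp_extra boolp classical_sets functions cardinality reals.
From mathcomp Require Import complex.

Set Implicit Arguments.
Unset Strict Implicit.
Unset Printing Implicit Defensive.

Import Order.TTheory GRing.Theory Num.Theory.
Local Open Scope ring_scope.
Local Open Scope complex_scope.
Local Open Scope classical_set_scope.

(* The underlying set is {0, 1, 2, ...} instead of {1, 2, 3, ...}. *)
Record finperm := FinPerm {
  finperm_fun :> nat -> nat;
  finperm_bij : bijective finperm_fun;
  finperm_fin : finite_set [set n : nat | finperm_fun n <> n]
}.

HB.instance Definition _ := gen_eqMixin finperm.
HB.instance Definition _ := gen_choiceMixin finperm.

Lemma finpermP (v w : finperm) : v =1 w -> v = w.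
Proof.
case: v w => [f fb ff] [g gb gf] /= /funext fg.
move: fb ff; rewrite fg => fb ff.
by congr FinPerm; exact: Prop_irrelevance.
Qed.

Lemma finperm_one_fin : finite_set [set n : nat | (id : nat -> nat) n <> n].
Proof. by rewrite (_ : mkset _ = set0) ?eqEsubset//; split=> // n /= []. Qed.

Definition finperm_one : finperm :=
  FinPerm (Bijective (frefl id) (frefl id)) finperm_one_fin.

Lemma finperm_mul_fin (v w : finperm) :
  finite_set [set n : nat | (v \o w) n <> n].
Proof.
apply: (@sub_finite_set _ _
  ([set n : nat | v n <> n] `|` [set n : nat | w n <> n])); last first.
  by rewrite finite_setU; split; apply: finperm_fin.
move=> n /= vwn; have [wn|wn] := pselect (w n = n); last by right.
by left => vn; apply: vwn; rewrite wn.
Qed.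

Definition finperm_mul (v w : finperm) : finperm :=
  FinPerm (bij_comp (finperm_bij v) (finperm_bij w)) (finperm_mul_fin v w).

Lemma finperm_has_inv (w : finperm) :
  exists g : nat -> nat, cancel w g /\ cancel g w.
Proof. by case: (finperm_bij w) => g wg gw; exists g. Qed.

Definition finperm_inv_fun (w : finperm) : nat -> nat :=
  projT1 (cid (finperm_has_inv w)).

Lemma finperm_funK (w : finperm) : cancel w (finperm_inv_fun w).
Proof. by rewrite /finperm_inv_fun; case: cid => g /= []. Qed.

Lemma finperm_inv_funK (w : finperm) : cancel (finperm_inv_fun w) w.
Proof. by rewrite /finperm_inv_fun; case: cid => g /= []. Qed.

Lemma finperm_inv_fin (w : finperm) :
  finite_set [set n : nat | finperm_inv_fun w n <> n].
Proof.
apply: sub_finite_set (finperm_fin w) => n /= wn wE; apply: wn.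
by rewrite -[in LHS]wE finperm_funK.
Qed.

Definition finperm_inv (w : finperm) : finperm :=
  FinPerm (Bijective (finperm_inv_funK w) (finperm_funK w)) (finperm_inv_fin w).

Lemma finperm_mulA : associative finperm_mul.
Proof. by move=> u v w; apply: finpermP. Qed.

Lemma finperm_mul1 : left_id finperm_one finperm_mul.
Proof. by move=> w; apply: finpermP. Qed.

Lemma finperm_mulr1 : right_id finperm_one finperm_mul.
Proof. by move=> w; apply: finpermP. Qed.

Lemma finperm_mulV : left_inverse finperm_one finperm_inv finperm_mul.
Proof. by move=> w; apply: finpermP => n /=; rewrite finperm_funK. Qed.

Lemma finperm_mulrV : right_inverse finperm_one finperm_inv finperm_mul.
Proof. by move=> w; apply: finpermP => n /=; rewrite finperm_inv_funK. Qed.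

HB.instance Definition _ := isGroup.Build finperm finperm_mulA finperm_mul1
  finperm_mulr1 finperm_mulV finperm_mulrV.

Definition adj_swap (n : nat) : nat -> nat :=
  fun k => if k == n then n.+1 else if k == n.+1 then n else k.

Lemma adj_swapK n : involutive (adj_swap n).
Proof.
move=> k; rewrite /adj_swap; have [->|kn] := eqVneq k n.
  by rewrite eqxx gtn_eqF.
by have [->|/negPf kSn] := eqVneq k n.+1; rewrite ?eqxx// (negPf kn) kSn.
Qed.

Lemma adj_swap_fin n : finite_set [set k : nat | adj_swap n k <> k].
Proof.
apply: (@sub_finite_set _ _ [set` [:: n; n.+1]]); last exact: finite_seq.
move=> k /=; rewrite /adj_swap !inE.
by case: eqP => //= _; case: eqP.
Qed.

Definition adj_transp (n : nat) : finperm :=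
  FinPerm (Bijective (adj_swapK n) (adj_swapK n)) (adj_swap_fin n).

Definition adj_transps : set finperm := range adj_transp.

Section ColourLength.
Local Open Scope group_scope.
Variables (G : groupType) (S : set G).

(* Generators are meant to be involutions, as in a Coxeter group, so that
   words need no inverse letters. *)
Definition is_word (w : G) (s : seq G) : Prop :=
  (forall x, x \in s -> S x) /\ \prod_(x <- s) x = w.

Definition reduced_word (w : G) (s : seq G) : Prop :=
  is_word w s /\ forall t, is_word w t -> (size s <= size t)%N.

(* The number of distinct letters of a chosen reduced word; the default value
   [::] is only used when w is not a product of elements of S. *)
Definition colour_length (w : G) : nat :=
  size (undup (xget [::] [set s | reduced_word w s])).

Lemma reduced_word_exists (w : G) :
  (exists s, is_word w s) -> exists s, reduced_word w s.
Proof.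
move=> [s sw].
have ex : exists n, `[< exists2 t, is_word w t & size t = n >].
  by exists (size s); apply/asboolP; exists s.
case: (ex_minnP ex) => _ /asboolP[t tw <-] tmin.
by exists t; split=> // u uw; apply: tmin; apply/asboolP; exists u.
Qed.

End ColourLength.

Lemma finperm_reduced_word (w : finperm) :
  exists s, reduced_word adj_transps w s.
Proof.
apply: reduced_word_exists.
have [N wN] : exists N, forall n, (N <= n)%N -> w n = n.
  have /finite_seqP[s sE] := finperm_fin w.
  exists (\max_(i <- s) i).+1 => n Nn; apply: contrapT => wn.
  have : n \in s by have : [set` s] n by rewrite -sE.
  by move=> /(@leq_bigmax_seq _ _ predT id) => /(_ isT); rewrite leqNgt Nn.
elim: N w wN => [|N IH] w wN.
  exists [::]; split => //; rewrite big_nil; apply: finpermP => n.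
  by rewrite wN.
have [d] : exists d, (N - w N)%N = d by eexists.
elim: d w wN => [|d IHd] w wN wd.
  apply: IH => n; rewrite leq_eqVlt => /predU1P[<-|/wN//].
  apply/eqP; move/eqP: wd; rewrite subn_eq0 leq_eqVlt eq_sym => /predU1P[->//|].
  by move=> /wN /(bij_inj (finperm_bij w)) /eqP.
have wNN : (w N < N)%N by rewrite -subn_gt0 wd.
have [n Nn||s [sS sE]] := IHd (adj_transp (w N) * w)%g.
- rewrite -[LHS]/(adj_swap (w N) (w n)) (wN n Nn) /adj_swap.
  by rewrite !gtn_eqF// ?(ltn_trans wNN Nn) ?(leq_ltn_trans wNN Nn).
- rewrite -[X in (N - X)%N]/(adj_swap (w N) (w N)) /adj_swap eqxx.
  by rewrite subnS wd.
exists (adj_transp (w N) :: s); split.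
  by move=> x; rewrite inE => /predU1P[->|/sS//]; exists (w N).
rewrite big_cons sE; apply: finpermP => n.
exact: (adj_swapK (w N) (w n)).
Qed.

(* On R[i], 0 <= z means that z is real and nonnegative. *)
Definition positive_definite (R : realType) (G : groupType) (phi : G -> R[i]) : Prop :=
  forall a : {fsfun G -> R[i] with 0},
    0 <= \sum_(x <- finsupp a) \sum_(y <- finsupp a)
           phi (y^-1 * x)%g * a x * (a y)^*.

(* Main.v *)
Require Import Defs.
From mathcomp Require Import all_boot all_order all_algebra all_fingroup.
From mathcomp Require Import finmap boolp classical_sets cardinality.
From mathcomp Require Import reals complex zify lra ring.

(** A position [n] is broken by [w] when [w] does not preserve the initial
    segment {0, ..., n}.  The generators in a reduced word of [w] are exactly
    the [adj_transp n] with [n] broken ([colour_lengthE]), so that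
      q ^ ||w|| = \prod_n (if n is broken by w then q else 1).

    For 0 <= q <= 1 this is positive definite: writing H_n for the stabiliser
    of {0, ..., n}, the factor at [n] is q + (1 - q) 1_{H_n}, and multiplying a
    positive semidefinite kernel by the indicator of an equivalence relation
    (here x H_n = y H_n) only cuts it into diagonal blocks ([psd_mix]).

    Conversely, the elements 1 and [adj_transp 0] with coefficients 1 and -1
    give 2 - 2q >= 0.  For q < 0 the test function is the indicator of S_N,
    which forces the sum of q ^ ||w|| over S_N to be nonnegative.  Most
    permutations of a large set preserve no proper initial segment, so this
    sum is close to N! q ^ (N - 1), which is negative for N even.  To control
    the error for a fixed q, put x = 1 / q and write the sum as q ^ N V_N,
    where V_N is the sum over S_N of x to the number of unbroken n < N.
    Splitting off the initial segment at each unbroken position yields the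
    renewal equation ([unbroken_sum_renewal])
      V_N = N! + (x - 1) \sum_(1 <= k <= N) k! V_(N - k).
    Its term k = N contributes (x - 1) N!.  The others are O((N - 1)!): since
    \sum_(1 <= k < N) k! (N - k)! <= 4 (N - 1)!, an induction first gives
    V_N = O(N!), and then the same estimate applies again.  Hence V_N / N!
    tends to x < 0 ([renewal_bound]). *)

Set Implicit Arguments.
Unset Strict Implicit.
Unset Printing Implicit Defensive.

Import Order.TTheory GRing.Theory Num.Theory.
Local Open Scope ring_scope.
Local Open Scope complex_scope.

(** * Colour length and preserved initial segments *)

Definition broken (w : nat -> nat) (n : nat) : bool :=
  [exists a : 'I_n.+1, (n < w a)%N].

Lemma unbrokenP (w : nat -> nat) n :
  reflect (forall a, (a <= n -> w a <= n)%N) (~~ broken w n).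
Proof.
rewrite negb_exists; apply: (iffP forallP) => [wn a an|wn a].
  by have := wn (Ordinal (n:=n.+1) (m:=a) an); rewrite -leqNgt.
by rewrite -leqNgt wn // -ltnS.
Qed.

(** A map of {0, ..., n} into itself that is injective is onto. *)
Lemma unbroken_image (w : finperm) n b :
  ~~ broken w n -> (b <= n)%N -> exists2 a, (a <= n)%N & w a = b.
Proof.
move=> /unbrokenP wn bn.
pose f (a : 'I_n.+1) : 'I_n.+1 := inord (w a).
have fE a : f a = w a :> nat by rewrite inordK // ltnS wn // -ltnS.
have fI : injective f.
  move=> a c /(congr1 val); rewrite /= !fE => /(bij_inj (finperm_bij w)).
  exact: val_inj.
have [g _ gK] := injF_bij fI.
exists (g (inord b)); first by rewrite -ltnS.
by rewrite -fE gK inordK.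
Qed.

Lemma unbroken_ge (w : finperm) n a : ~~ broken w n -> (n < a -> n < w a)%N.
Proof.
move=> wn na; rewrite ltnNge; apply/negP => /(unbroken_image wn)[c cn].
by move/(bij_inj (finperm_bij w)) => ca; rewrite -ca ltnNge cn in na.
Qed.

Lemma unbroken_mul (v w : finperm) n :
  ~~ broken v n -> ~~ broken w n -> ~~ broken (v * w)%g n.
Proof.
by move=> /unbrokenP vn /unbrokenP wn; apply/unbrokenP => a /wn /vn.
Qed.

Lemma unbroken_one n : ~~ broken (1%g : finperm) n.
Proof. exact/unbrokenP. Qed.

Lemma unbroken_adj m n : m != n -> ~~ broken (adj_transp m) n.
Proof.
move=> mn; apply/unbrokenP => a /=; rewrite /adj_swap.
by case: eqP => [|_]; [|case: eqP]; lia.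
Qed.

Definition word_prod (l : seq nat) : finperm := (\prod_(n <- l) adj_transp n)%g.

Lemma word_prod_cons n l k : word_prod (n :: l) k = adj_swap n (word_prod l k).
Proof. by rewrite /word_prod big_cons. Qed.

Lemma word_prod_cat l m k : word_prod (l ++ m) k = word_prod l (word_prod m k).
Proof. by rewrite /word_prod big_cat. Qed.

(** All the generators but [adj_transp n] preserve {0, ..., n}. *)
Lemma word_prod_avoid n l : n \notin l -> ~~ broken (word_prod l) n.
Proof.
rewrite /word_prod; elim: l => [|m l IH]; first by rewrite big_nil unbroken_one.
rewrite inE negb_or eq_sym big_cons => /andP[mn nl].
by apply: unbroken_mul; [exact: unbroken_adj|exact: IH].
Qed.

Definition nat_swap (i j k : nat) : nat :=
  if k == i then j else if k == j then i else k.

Lemma inj_nat_swap (f : nat -> nat) i j k :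
  injective f -> f (nat_swap i j k) = nat_swap (f i) (f j) (f k).
Proof.
by move=> fI; rewrite /nat_swap !(inj_eq fI); case: ifP => // _; case: ifP.
Qed.

(** The exchange property.  The positions [ai] and [aj], which the word maps
    to [i] and [j], start in the opposite order, so some letter interchanges
    the two; deleting this letter has the effect of exchanging [i] and [j]
    at the end. *)
Lemma word_exchange l i j ai aj : (i < j)%N -> (aj < ai)%N ->
  word_prod l ai = i -> word_prod l aj = j ->
  exists2 l', size l = (size l').+1 &
    forall k, word_prod l' k = nat_swap i j (word_prod l k).
Proof.
elim: l i j => [|m l IH] i j ij aji.
  by rewrite /word_prod big_nil => h1 h2; move: (h1 : ai = i) (h2 : aj = j); lia.
rewrite !word_prod_cons => ei ej.
have [/andP[/eqP im /eqP jm]|im] := boolP ((i == m) && (j == m.+1)).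
  exists l => // k; rewrite word_prod_cons; move: (word_prod l k) => b.
  by rewrite im jm -[nat_swap _ _]/(adj_swap m) adj_swapK.
have {}ei : word_prod l ai = adj_swap m i by rewrite -ei adj_swapK.
have {}ej : word_prod l aj = adj_swap m j by rewrite -ej adj_swapK.
have [|l' sl l'E] := IH _ _ _ aji ei ej.
  by rewrite /adj_swap; do ![case: eqP => ?]; lia.
exists (m :: l'); first by rewrite /= sl.
move=> k; rewrite !word_prod_cons l'E; move: (word_prod l k) => b.
by rewrite (inj_nat_swap _ _ _ (can_inj (adj_swapK m))) !adj_swapK.
Qed.

(** If {0, ..., n} is preserved, the two points that the leftmost letter [n]
    carries across the boundary of this segment are also interchanged by
    another letter of the word; the two letters can be deleted together, and
    the word is not reduced. *)
Lemma reduced_broken l n :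
  (forall m, word_prod m = word_prod l -> size l <= size m)%N ->
  n \in l -> broken (word_prod l) n.
Proof.
move=> + nl; pose p := take (index n l) l; pose r := drop (index n l).+1 l.
have np : n \notin p by rewrite in_take_leq ?ltnn // index_size.
have -> : l = p ++ n :: r.
  by rewrite -{1}(cat_take_drop (index n l) l) (drop_nth 0%N) ?index_mem // nth_index.
move=> lmin; apply: contraT => ln.
have pn := word_prod_avoid np.
have wpE k : word_prod (p ++ n :: r) k = word_prod p (adj_swap n (word_prod r k)).
  by rewrite word_prod_cat word_prod_cons.
have [g _ gK] := finperm_bij (word_prod r).
(* The suffix [r] already has the two points in inverted order, and the letter
   [n] undoes this: it can be absorbed by an exchange in [r]. *)
have [r' sr r'E] : exists2 r', size r = (size r').+1 &
    forall k, word_prod r' k = nat_swap n n.+1 (word_prod r k).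
  apply: (@word_exchange r n n.+1 (g n) (g n.+1)) => //.
  have gnn : (n < g n)%N.
    rewrite ltnNge; apply/negP; move/unbrokenP: (ln) => /[apply].
    rewrite wpE gK /adj_swap eqxx leqNgt.
    by rewrite (unbroken_ge pn).
  suff : (g n.+1 <= n)%N by move=> h; apply: leq_ltn_trans gnn.
  rewrite leqNgt; apply/negP => /(unbroken_ge ln).
  rewrite wpE gK /adj_swap eqxx gtn_eqF // ltnNge.
  by move/unbrokenP: pn => ->.
have := lmin (p ++ r'); rewrite !size_cat /= sr => lm.
suff /lm : word_prod (p ++ r') = word_prod (p ++ n :: r) by lia.
by apply: finpermP => k; rewrite wpE word_prod_cat r'E.
Qed.

Lemma adj_transp_inj : injective adj_transp.
Proof.
move=> m n /(congr1 (fun w : finperm => w m)); rewrite /= /adj_swap eqxx.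
by do ![case: eqP => ?]; lia.
Qed.

Lemma is_wordE (w : finperm) (s : seq finperm) :
  is_word adj_transps w s <-> exists2 l, s = map adj_transp l & word_prod l = w.
Proof.
split=> [[sS <-]|[l -> <-]]; last first.
  by split=> [x /mapP[n _ ->]|]; [exists n|rewrite big_map].
rewrite /word_prod; elim: s sS => [|x s IH] sS.
  by exists [::]; rewrite ?big_nil.
have [n _ nx] := sS x (mem_head _ _).
have [y ys|l -> lE] := IH; first by apply: sS; rewrite inE ys orbT.
by exists (n :: l); rewrite ?big_cons ?lE -nx.
Qed.

Lemma colour_lengthE (w : finperm) N : (forall n, N <= n -> w n = n)%N ->
  colour_length adj_transps w = (\sum_(n < N) broken w n)%N.
Proof.
move=> wN; rewrite /colour_length.
case: xgetP => [s _ [/is_wordE[l -> lw] lmin]|]; last first.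
  by have [s sw] := finperm_reduced_word w => /(_ s).
rewrite undup_map_inj; last by apply: adj_transp_inj.
rewrite size_map.
have -> : (\sum_(n < N) broken w n)%N = size (filter (broken w) (iota 0 N)).
  rewrite size_filter -sumn_count sumnE big_map.
  by rewrite -(big_mkord xpredT (fun n => broken w n : nat)) /index_iota subn0.
apply: perm_size; apply: uniq_perm; rewrite ?undup_uniq ?filter_uniq ?iota_uniq //.
move=> n; rewrite mem_undup mem_filter mem_iota add0n leq0n /=.
apply/idP/idP => [nl|/andP[wn _]]; last first.
  by apply: contraLR wn => /word_prod_avoid; rewrite lw.
have wn : broken w n.
  rewrite -lw; apply: reduced_broken nl => m lm.
  have : is_word adj_transps w (map adj_transp m).
    by apply/is_wordE; exists m => //; rewrite -lw.
  by move/lmin; rewrite !size_map.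
rewrite wn /= ltnNge; apply: contraL wn => Nn; apply/unbrokenP => a an.
rewrite leqNgt; apply/negP => nwa.
have /wN/(bij_inj (finperm_bij w)) E : (N <= w a)%N by lia.
by lia.
Qed.

(** * Positive semidefinite kernels *)

Definition psd_kernel (R : rcfType) (T : eqType) (K : T -> T -> R[i]) : Prop :=
  forall (s : seq T) (a : T -> R[i]),
    0 <= \sum_(x <- s) \sum_(y <- s) K x y * a x * (a y)^*.

Lemma psd_one (R : rcfType) (T : eqType) : psd_kernel (fun _ _ : T => 1 : R[i]).
Proof.
move=> s a.
suff -> : \sum_(x <- s) \sum_(y <- s) 1 * a x * (a y)^* =
          (\sum_(x <- s) a x) * (\sum_(x <- s) a x)^*.
  exact: mul_conjC_ge0.
rewrite rmorph_sum mulr_suml; apply: eq_bigr => x _; rewrite mulr_sumr.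
by apply: eq_bigr => y _; rewrite mul1r.
Qed.

(** Restricting a kernel to the classes of [c] gives the sum, over the classes,
    of the same form evaluated at [a] cut down to the class. *)
Lemma psd_block (R : rcfType) (T : eqType) (I : eqType) (c : T -> I)
    (K : T -> T -> R[i]) :
  psd_kernel K -> psd_kernel (fun x y => if c x == c y then K x y else 0).
Proof.
move=> Kp s a.
pose b k x := if c x == k then a x else 0.
suff -> : \sum_(x <- s) \sum_(y <- s)
            (if c x == c y then K x y else 0) * a x * (a y)^* =
    \sum_(k <- undup (map c s))
      \sum_(x <- s) \sum_(y <- s) K x y * b k x * (b k y)^*.
  by apply: sumr_ge0 => k _; exact: Kp.
rewrite [RHS]exchange_big; apply: eq_big_seq => /= x xs.
rewrite [RHS]exchange_big; apply: eq_bigr => /= y _.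
have cxs : c x \in undup (map c s) by rewrite mem_undup map_f.
(* Only the class of [x] contributes to the sum over the classes. *)
rewrite (bigD1_seq (c x)) ?undup_uniq //= big1 ?addr0 => [|k /negbTE kx].
  by rewrite /b eqxx (eq_sym (c y)); case: ifP => _ //;
    rewrite !mul0r rmorph0 mulr0.
by rewrite /b (eq_sym (c x)) kx mulr0 mul0r.
Qed.

(** The factor is the convex combination of the constant 1 and of the
    indicator of [c x = c y], with weights [q] and [1 - q]. *)
Lemma psd_mix (R : rcfType) (T : eqType) (I : eqType) (c : T -> I) (q : R)
    (K : T -> T -> R[i]) : 0 <= q <= 1 -> psd_kernel K ->
  psd_kernel (fun x y => (if c x == c y then 1 else q%:C) * K x y).
Proof.
move=> /andP[q0 q1] Kp s a.
have -> : \sum_(x <- s) \sum_(y <- s)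
     (if c x == c y then 1 else q%:C) * K x y * a x * (a y)^* =
   q%:C * (\sum_(x <- s) \sum_(y <- s) K x y * a x * (a y)^*) +
   (1 - q)%:C * (\sum_(x <- s) \sum_(y <- s)
     (if c x == c y then K x y else 0) * a x * (a y)^*).
  rewrite !mulr_sumr -big_split; apply: eq_bigr => x _.
  rewrite !mulr_sumr -big_split; apply: eq_bigr => y _ /=.
  by rewrite rmorphB /= rmorph1; case: eqP => _; ring.
by rewrite addr_ge0 // mulr_ge0 ?ler0c ?subr_ge0 //; exact: psd_block.
Qed.

Lemma psd_mix_prod (R : rcfType) (T : eqType) (I : eqType) (c : nat -> T -> I)
    (q : R) N : 0 <= q <= 1 ->
  psd_kernel (fun x y => \prod_(n < N) (if c n x == c n y then 1 else q%:C)).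
Proof.
move=> q01; elim: N => [|N IH] s a.
  under eq_bigr do under eq_bigr do rewrite big_ord0.
  exact: psd_one.
have := psd_mix (c N) q01 IH s a; congr (_ <= _).
apply: eq_bigr => x _; apply: eq_bigr => y _.
by rewrite big_ord_recr /= [X in X * a x]mulrC.
Qed.

(** The positivity condition for coefficients given on a duplicate-free list,
    without reference to the exact support. *)
Lemma positive_definite_seq (R : realType) (G : groupType) (phi : G -> R[i])
    (s : seq G) (b : G -> R[i]) : positive_definite phi -> uniq s ->
  0 <= \sum_(x <- s) \sum_(y <- s) phi (y^-1 * x)%g * b x * (b y)^*.
Proof.
move=> phiP us.
pose a : {fsfun G -> R[i] with 0} := [fsfun x in [fset x in s]%fset => b x].
have aE x : x \in s -> a x = b x by move=> xs; rewrite fsfunE inE /= xs.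
have suppE (F : G -> R[i]) : (forall x, a x = 0 -> F x = 0) ->
    \sum_(x <- finsupp a) F x = \sum_(x <- s) F x.
  move=> F0; rewrite [RHS](bigID (fun x => x \in finsupp a)) /=.
  rewrite [X in _ = _ + X]big1 ?addr0 => [|x xa]; last exact/F0/fsfun_dflt.
  rewrite -[RHS]big_filter; apply: perm_big.
  apply: uniq_perm; rewrite ?filter_uniq ?fset_uniq // => x.
  rewrite mem_filter; case xa: (x \in finsupp a) => //=.
  by move: xa; rewrite mem_finsupp fsfunE inE /=; case: (x \in s); rewrite ?eqxx.
have := phiP a; rewrite suppE => [|x ax]; last first.
  by apply: big1 => y _; rewrite ax mulr0 mul0r.
congr (_ <= _); apply: eq_big_seq => x xs.
rewrite suppE => [|y ay]; last by rewrite ay rmorph0 mulr0.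
by apply: eq_big_seq => y ys; rewrite !aE.
Qed.

(** * Sufficiency of 0 <= q <= 1 *)

(** The kernel attached to the stabiliser of {0, ..., n} compares the images
    of this segment, which label its left cosets. *)
Lemma broken_divE (x y : finperm) n :
  broken (y^-1 * x)%g n =
  ((x @` `I_n.+1)%classic != (y @` `I_n.+1)%classic).
Proof.
have yxE k : y ((y^-1 * x)%g k) = x k by rewrite /= finperm_inv_funK.
apply: negb_inj; rewrite negbK; apply/idP/eqP => xy; last first.
  apply/unbrokenP => a an.
  have : (x @` `I_n.+1)%classic (x a) by exists a.
  by rewrite xy => -[b bn]; rewrite -yxE => /(bij_inj (finperm_bij y)) <-.
apply/seteqP; split=> k [a an <-].
  by exists ((y^-1 * x)%g a) => //; move/unbrokenP : xy; apply.
by have [c cn <-] := unbroken_image xy an; exists c.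
Qed.

Lemma finperm_bound (w : finperm) : exists N, forall n, (N <= n -> w n = n)%N.
Proof.
have /finite_seqP[s sE] := finperm_fin w.
exists (\max_(i <- s) i).+1 => n Nn; apply: contrapT => wn.
have : n \in s by have : [set` s]%classic n by rewrite -sE.
by move=> /(@leq_bigmax_seq _ _ predT id) => /(_ isT); rewrite leqNgt Nn.
Qed.

Lemma finperm_bound_seq (s : seq finperm) :
  exists N, forall w, w \in s -> forall n, (N <= n -> w n = n)%N.
Proof.
elim: s => [|v s [N sN]]; first by exists 0%N.
have [M vM] := finperm_bound v; exists (maxn M N) => w.
rewrite inE => /predU1P[->|ws] n; rewrite geq_max => /andP[Mn Nn]; first exact: vM.
exact: sN.
Qed.

Lemma expr_colour_length (R : comNzRingType) (q : R) (w : finperm) N :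
  (forall n, N <= n -> w n = n)%N ->
  q ^+ colour_length adj_transps w = \prod_(n < N) (if broken w n then q else 1).
Proof.
move=> wN; rewrite (colour_lengthE wN) expr_sum.
by apply: eq_bigr => n _; case: broken.
Qed.

Lemma positive_definite_expr_colour_length (R : realType) (q : R) : 0 <= q <= 1 ->
  positive_definite (fun w : finperm => (q ^+ colour_length adj_transps w)%:C).
Proof.
move=> q01 a; have [N aN] := finperm_bound_seq (finsupp a).
have := psd_mix_prod (fun n (x : finperm) => (x @` `I_n.+1)%classic) N q01
  (finsupp a) a.
congr (_ <= _); apply: eq_big_seq => x xa; apply: eq_big_seq => y ya.
congr (_ * _ * _); rewrite (@expr_colour_length _ _ _ N) => [|n Nn].
  rewrite rmorph_prod; apply: eq_bigr => n _.
  by rewrite broken_divE; case: eqP => /=.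
by apply: (bij_inj (finperm_bij y)); rewrite /= finperm_inv_funK !aN.
Qed.

(** * Finite symmetric groups inside the finitary one *)

Section Embedding.
Variable N : nat.
Implicit Types s t : {perm 'I_N}.

Definition perm_fun s (k : nat) : nat :=
  oapp (fun i : 'I_N => s i : nat) k (insub k).

Lemma perm_fun_ord s (i : 'I_N) : perm_fun s i = s i.
Proof. by rewrite /perm_fun valK. Qed.

Lemma perm_fun_ge s k : (N <= k)%N -> perm_fun s k = k.
Proof. by move=> Nk; rewrite /perm_fun insubN // -leqNgt. Qed.

Lemma perm_fun_lt s k : (k < N)%N -> (perm_fun s k < N)%N.
Proof. by move=> kN; rewrite (perm_fun_ord s (Ordinal kN)). Qed.

Lemma perm_funM s t k : perm_fun (s * t) k = perm_fun t (perm_fun s k).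
Proof.
have [Nk|kN] := leqP N k; first by rewrite !perm_fun_ge.
by rewrite -[k]/(val (Ordinal kN)) !perm_fun_ord permM.
Qed.

Lemma perm_fun1 k : perm_fun 1 k = k.
Proof.
have [Nk|kN] := leqP N k; first by rewrite !perm_fun_ge.
by rewrite -[k]/(val (Ordinal kN)) !perm_fun_ord perm1.
Qed.

Lemma perm_funK s : cancel (perm_fun s) (perm_fun s^-1).
Proof. by move=> k; rewrite -perm_funM mulgV perm_fun1. Qed.

Lemma perm_funVK s : cancel (perm_fun s^-1) (perm_fun s).
Proof. by move=> k; rewrite -perm_funM mulVg perm_fun1. Qed.

Lemma perm_fun_fin s : finite_set [set k | perm_fun s k <> k].
Proof.
apply: sub_finite_set (finite_II N) => k /=; rewrite ltnNge => ks.
by apply/negP => /perm_fun_ge.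
Qed.

Definition finperm_of_perm s : finperm :=
  FinPerm (Bijective (perm_funK s) (perm_funVK s)) (perm_fun_fin s).

Lemma finperm_of_perm_inj : injective finperm_of_perm.
Proof.
move=> s t st; apply/permP => i; apply: val_inj.
by rewrite /= -!perm_fun_ord -[perm_fun s]/(finperm_of_perm s : nat -> nat) st.
Qed.

(** The order of the factors is reversed because products of [{perm 'I_N}]
    are applied from left to right, those of [finperm] from right to left. *)
Lemma finperm_of_perm_div s t :
  ((finperm_of_perm t)^-1 * finperm_of_perm s)%g = finperm_of_perm (s * t^-1).
Proof.
apply: (canLR (mulKg _)); apply: finpermP => k /=.
by rewrite -perm_funM mulgKV.
Qed.

End Embedding.

(** * Counting unbroken positions over S_N *)

Lemma unbroken_perm_fun_last N (s : {perm 'I_N.+1}) : ~~ broken (perm_fun s) N.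
Proof. by apply/unbrokenP => a aN; rewrite -ltnS perm_fun_lt. Qed.

(** [lift_perm ord_max i u] sends the last point to [i] and follows [u] by the
    shift of {i, i+1, ...}: a segment ending at or after [i] receives the last
    point, and a shorter one is not affected by the shift. *)
Lemma broken_lift N (i : 'I_N.+1) (u : {perm 'I_N}) n : (n < N)%N ->
  broken (perm_fun (lift_perm ord_max i u)) n = (i <= n)%N || broken (perm_fun u) n.
Proof.
move=> nN; set w := lift_perm _ _ _.
have wN : perm_fun w N = i by rewrite (perm_fun_ord w ord_max) lift_perm_id.
have wlt k : (k < N)%N -> perm_fun w k = bump i (perm_fun u k).
  move=> kN; have kE : k = lift ord_max (Ordinal kN) :> nat.
    by rewrite /= /bump leqNgt kN.
  rewrite [in LHS]kE perm_fun_ord lift_perm_lift /=.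
  by rewrite -(perm_fun_ord u (Ordinal kN)).
have [le_in|lt_ni] /= := leqP i n.
  apply: contraT => wn.
  have := @unbroken_ge (finperm_of_perm w) _ _ wn nN.
  by rewrite /= wN ltnNge le_in.
apply: negb_inj; apply/unbrokenP/unbrokenP => un a an; have := un a an.
  by rewrite wlt ?(leq_ltn_trans an) // /bump; case: leqP; lia.
by rewrite wlt ?(leq_ltn_trans an) // /bump; case: leqP; lia.
Qed.

(** The generating function of the number of unbroken positions below [j] on
    S_N.  The cutoff [j] makes the recursion on [N] possible. *)
Definition unbroken_sum (R : comNzRingType) (x : R) (N j : nat) : R :=
  \sum_(s : {perm 'I_N}) \prod_(n < j) (if broken (perm_fun s) n then 1 else x).

Section UnbrokenSum.
Variables (R : comNzRingType) (x : R).
Local Notation W := (unbroken_sum x).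

(** Write each permutation as [lift_perm ord_max i u]: its unbroken positions
    below [j <= N] are those of [u] below [minn i j]. *)
Lemma unbroken_sum_rec N j : (j <= N)%N ->
  W N.+1 j = \sum_(i < N.+1) W N (minn i j).
Proof.
move=> jN; rewrite pair_bigA /=.
rewrite /unbroken_sum (reindex
  (fun p : 'I_N.+1 * {perm 'I_N} => lift_perm ord_max p.1 p.2)).
  apply: eq_bigr => -[i u] _ /=.
  rewrite (big_ord_widen j (fun n => if broken (perm_fun u) n then 1 else x)
    (geq_minr i j)) [RHS]big_mkcond /=.
  apply: eq_bigr => n _; rewrite broken_lift; last exact: leq_trans jN.
  by rewrite ltn_min ltn_ord andbT; case: ltnP.
apply/onW_bij/inj_card_bij; last by rewrite card_prod !card_Sn card_ord factS.
move=> [i u] [k v] /= E.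
have ik : i = k by rewrite -(lift_perm_id ord_max i u) E lift_perm_id.
rewrite -ik in E *; congr (_, _); apply/permP => a; apply: (@lift_inj _ i).
by rewrite -!(lift_perm_lift ord_max) E.
Qed.

Lemma unbroken_sum_full N : W N.+1 N.+1 = x * W N.+1 N.
Proof.
rewrite /unbroken_sum mulr_sumr; apply: eq_bigr => s _.
by rewrite big_ord_recr /= (negbTE (unbroken_perm_fun_last s)) mulrC.
Qed.

Lemma unbroken_sum00 : W 0 0 = 1.
Proof.
rewrite /unbroken_sum; under eq_bigr do rewrite big_ord0.
by rewrite sumr_const card_Sn.
Qed.

(** If m positions below [j] are unbroken, then x ^ m - 1 is the sum, over these
    positions k, of (x - 1) times x to the number of those beyond k.  The
    permutations preserving {0, ..., k} form a product of S_(k+1), which is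
    counted without weight, and of S_(N-k-1).  The proof is an induction
    through [unbroken_sum_rec]; the case [j = N] of a new [N] is
    [unbroken_sum_full]. *)
Lemma unbroken_sum_renewal N j : (j <= N)%N ->
  W N j = N`!%:R + (x - 1) * \sum_(k < j) k.+1`!%:R * W (N - k.+1) (j - k.+1).
Proof.
elim: N j => [|N IH] j.
  by rewrite leqn0 => /eqP->; rewrite unbroken_sum00 big_ord0 mulr0 addr0.
have main m : (m <= N)%N -> W N.+1 m = N.+1`!%:R +
    (x - 1) * \sum_(k < m) k.+1`!%:R * W (N - k) (m - k.+1).
  move=> mN; rewrite unbroken_sum_rec //.
  under eq_bigr => i _ do rewrite IH ?(leq_trans (geq_minr _ _)) //.
  rewrite big_split /= sumr_const card_ord -mulrnA mulnC -factS; congr (_ + _).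
  rewrite -mulr_sumr; congr (_ * _).
  transitivity (\sum_(i < N.+1) \sum_(k < m | (k < minn i m)%N)
      k.+1`!%:R * W (N - k.+1) (minn i m - k.+1)).
    apply: eq_bigr => i _; exact: (big_ord_widen m
      (fun k => k.+1`!%:R * W (N - k.+1) (minn i m - k.+1)) (geq_minr i m)).
  rewrite (exchange_big_dep xpredT) //=; apply: eq_bigr => k _.
  rewrite -mulr_sumr; congr (_ * _).
  have kN : (k < N)%N by exact: leq_trans mN.
  rewrite -[(N - k)%N]prednK ?subn_gt0 // unbroken_sum_rec; last by lia.
  (* The indices [i <= k] contribute nothing; shift the others by [k.+1]. *)
  rewrite -(big_mkord (fun i => k < minn i m)%N
    (fun i => W (N - k.+1) (minn i m - k.+1))).
  rewrite -(big_mkord xpredT (fun i => W (N - k).-1 (minn i (m - k.+1)))).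
  rewrite (@big_cat_nat _ _ _ k.+1) //=; last by lia.
  rewrite big_nat_cond big1 ?add0r => [|i]; last by rewrite ltn_min; lia.
  rewrite -[index_iota k.+1 _]/(index_iota (0 + k.+1) _) big_addn.
  rewrite prednK ?subn_gt0 // subSS; apply: eq_big => [i|i _].
    by have := ltn_ord k; rewrite ltn_min; lia.
  by congr (W _ _); lia.
rewrite leq_eqVlt => /predU1P[->|]; last first.
  by rewrite ltnS => /main.
rewrite unbroken_sum_full main // big_ord_recr /= !subnn unbroken_sum00 mulr1.
rewrite [X in _ = _ + _ * (X + _)](eq_bigr
  (fun k : 'I_N => x * (k.+1`!%:R * W (N - k) (N - k.+1)))).
  by rewrite -mulr_sumr; ring.
move=> k _; rewrite subSS mulrCA; congr (_ * _).
have := ltn_ord k; rewrite -subn_gt0; case: (N - k)%N (subnS N k) => // d -> _.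
by rewrite unbroken_sum_full.
Qed.
End UnbrokenSum.

(** * Asymptotics of the renewal equation *)

Lemma leq_fact_mul a b : (1 < a)%N -> (1 < b)%N ->
  (a`! * b`! <= 2 * (a + b - 2)`!)%N.
Proof.
case: a => [|[|a]] //; case: b => [|[|b]] // _ _.
elim: a => [|a IH]; first by rewrite leq_pmul2l //; apply/eqP.
rewrite factS -mulnA (leq_trans (leq_mul (leqnn _) IH)) //.
have -> : (a.+3 + b.+2 - 2 = (a.+2 + b.+2 - 2).+1)%N by lia.
by rewrite factS mulnCA leq_pmul2l // leq_mul2r; apply/orP; right; lia.
Qed.

(** The two extreme terms equal N!, and the N - 2 others are at most
    2 (N - 1)! each. *)
Lemma leq_sum_fact_mul N : (\sum_(k < N) k.+1`! * (N - k)`! <= 4 * N`!)%N.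
Proof.
case: N => [|[|N]]; rewrite ?big_ord0 ?big_ord1 //.
rewrite big_ord_recl big_ord_recr /= subn0.
have -> : (N.+2 - bump 0 N = 1)%N by rewrite /bump; lia.
have : (\sum_(i < N) (bump 0 i).+1`! * (N.+2 - bump 0 i)`! <= N * (2 * N.+1`!))%N.
  rewrite -[X in (_ <= X * _)%N]card_ord -sum_nat_const; apply: leq_sum => i _.
  have := @leq_fact_mul (bump 0 i).+1 (N.+2 - bump 0 i).
  have := ltn_ord i; rewrite /bump /=.
  have -> : ((1 + i).+1 + (N.+2 - (1 + i)) - 2 = N.+1)%N by have := ltn_ord i; lia.
  by move=> iN; apply; lia.
rewrite -[(bump 0 N).+1]/N.+2 !(factS N.+1) (_ : 1`! = 1)%N // mul1n muln1.
by move: (\sum_(i < N) _)%N N.+1`! => S f; nia.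
Qed.

(** The hypothesis is the renewal equation with its last term split off.  Let
    c = |x - 1|.  If |V_m| <= M m! for m <= N, the remaining sum is at most
    4 c M N!, hence at most (M / 2) (N + 1)! as soon as N + 1 >= 8 c.  So a
    constant M >= 2 |x| for which |V_m| <= M m! at small m works for all m,
    and 4 c M is then the bound sought. *)
Lemma renewal_bound (R : archiRealFieldType) (x : R) (V : nat -> R) :
  (forall N, V N.+1 = N.+1`!%:R * x +
      (x - 1) * \sum_(k < N) k.+1`!%:R * V (N - k)%N) ->
  exists2 M, 0 <= M & forall N, `|V N.+1 - N.+1`!%:R * x| <= M * N`!%:R.
Proof.
move=> VS; set c : R := `|x - 1|.
have step (M : R) N : 0 <= M -> (forall m, (m <= N)%N -> `|V m| <= M * m`!%:R) ->
    `|V N.+1 - N.+1`!%:R * x| <= 4 * c * M * N`!%:R.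
  move=> M0 VM; rewrite VS addrAC subrr add0r normrM -/c.
  rewrite [4 * c]mulrC -!mulrA; apply: ler_wpM2l; first exact: normr_ge0.
  apply: le_trans (ler_norm_sum _ _ _) _.
  apply: (@le_trans _ _ (\sum_(k < N) M * (k.+1`! * (N - k)`!)%N%:R)).
    apply: ler_sum => k _; rewrite normrM normr_nat natrM mulrCA.
    by apply: ler_wpM2l => //; apply: VM; lia.
  rewrite -mulr_sumr -natr_sum mulrCA; apply: ler_wpM2l => //.
  by rewrite -natrM ler_nat leq_sum_fact_mul.
pose K := Num.bound (8 * c).
have Kc : 8 * c < K%:R by apply: archi_boundP; rewrite mulr_ge0 ?normr_ge0.
pose M := 2 * `|x| + \sum_(m < K.+1) `|V m|.
have M0 : 0 <= M by rewrite addr_ge0 ?mulr_ge0 ?sumr_ge0.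
have VM N : `|V N| <= M * N`!%:R.
  elim/ltn_ind: N => N IH.
  have [NK|] := ltnP N K.+1.
    apply: (@le_trans _ _ M); last by rewrite ler_peMr // ler1n fact_gt0.
    rewrite /M (bigD1 (Ordinal NK)) //= addrCA lerDl addr_ge0 ?mulr_ge0 //.
    exact: sumr_ge0.
  case: N IH => // N IH KN.
  have := step M N M0 IH.
  have xM : 2 * `|x| <= M by rewrite lerDl sumr_ge0.
  have NE : N.+1`!%:R = N.+1%:R * N`!%:R :> R by rewrite factS natrM.
  have KNR : K%:R <= N.+1%:R :> R by rewrite ler_nat ltnW.
  have f0 : 0 <= N`!%:R :> R by exact: ler0n.
  have nx : `|N.+1`!%:R * x| = N.+1`!%:R * `|x| by rewrite normrM normr_nat.
  have := ler_normD (V N.+1 - N.+1`!%:R * x) (N.+1`!%:R * x).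
  rewrite subrK nx.
  have : 4 * c * M * N`!%:R <= N.+1%:R / 2 * M * N`!%:R.
    by do 2 (apply: ler_wpM2r => //); lra.
  have : N.+1`!%:R * (2 * `|x|) <= N.+1`!%:R * M by apply: ler_wpM2l.
  by rewrite NE; lra.
exists (4 * c * M); first by rewrite !mulr_ge0 ?normr_ge0.
by move=> N; apply: step.
Qed.

Lemma unbroken_sum_lt0 (R : archiRealFieldType) (x : R) : x < 0 ->
  exists N, forall n, (N <= n)%N -> unbroken_sum x n.+1 n.+1 < 0.
Proof.
move=> x0.
have [|M M0 VM] := @renewal_bound R x (fun n => unbroken_sum x n n).
  move=> N; rewrite unbroken_sum_renewal // big_ord_recr /= !subnn unbroken_sum00.
  by under eq_bigr do rewrite subSS; ring.
have Mx : 0 <= M / - x by rewrite divr_ge0 // oppr_ge0 ltW.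
exists (Num.bound (M / - x)) => n nB.
have : M / - x < n.+1%:R.
  by apply: lt_le_trans (archi_boundP Mx) _; rewrite ler_nat ltnW.
rewrite ltr_pdivrMr ?oppr_gt0 // => Mn.
have := VM n; rewrite ler_distl => /andP[_ /le_lt_trans]; apply.
have f0 : 0 < n`!%:R :> R by rewrite ltr0n fact_gt0.
rewrite factS natrM -mulrA [_ * (_ * x)]mulrCA [M * _]mulrC -mulrDr pmulr_rlt0 //.
by lra.
Qed.

(** * Necessity of 0 <= q <= 1 *)

(** Factor q out at every position below [N], broken or not. *)
Lemma sum_expr_colour_length (R : fieldType) (q : R) N : q != 0 ->
  \sum_(s : {perm 'I_N}) q ^+ colour_length adj_transps (finperm_of_perm s) =
  q ^+ N * unbroken_sum q^-1 N N.
Proof.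
move=> q0; rewrite mulr_sumr; apply: eq_bigr => s _.
rewrite (@expr_colour_length _ _ _ N) => [|n]; last exact: perm_fun_ge.
rewrite -[in q ^+ N](card_ord N) -prodr_const -big_split; apply: eq_bigr => n _ /=.
by case: broken; rewrite ?mulr1 ?mulfV.
Qed.

(** The double sum over S_N of a function of y^-1 x is N! times its sum. *)
Lemma sum_expr_colour_length_ge0 (R : realType) (q : R) N :
  positive_definite (fun w : finperm => (q ^+ colour_length adj_transps w)%:C) ->
  0 <= \sum_(s : {perm 'I_N}) q ^+ colour_length adj_transps (finperm_of_perm s).
Proof.
move=> qP; set S := \sum_(s : _) _.
have us : uniq (map (@finperm_of_perm N) (index_enum {perm 'I_N})).
  by rewrite map_inj_uniq ?index_enum_uniq //; exact: finperm_of_perm_inj.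
have := positive_definite_seq (fun=> 1) qP us.
rewrite big_map; under eq_bigr do rewrite big_map.
rewrite exchange_big (eq_bigr (fun=> S%:C)) => [|t _].
  rewrite sumr_const -raddfMn /= ler0c pmulrn_lge0 // card_Sn.
  exact: fact_gt0.
rewrite [LHS](reindex_inj (mulIg t)) rmorph_sum; apply: eq_bigr => s _ /=.
by rewrite finperm_of_perm_div mulgK rmorph1 !mulr1.
Qed.

Lemma colour_length1 : colour_length adj_transps (1%g : finperm) = 0%N.
Proof. by rewrite (@colour_lengthE _ 0) ?big_ord0. Qed.

Lemma colour_length_adj : colour_length adj_transps (adj_transp 0) = 1%N.
Proof.
rewrite (@colour_lengthE _ 2) => [|[|[|n]]] //.
have b0 : broken (adj_transp 0) 0.
  by apply: contraT => /unbrokenP /(_ 0%N (leqnn 0)).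
by rewrite !big_ord_recl big_ord0 /= b0 (negbTE (unbroken_adj _)).
Qed.

Theorem corollary6p4 (R : realType) (q : R) :
  positive_definite (fun w : finperm => (q ^+ colour_length adj_transps w)%:C)
  <-> 0 <= q <= 1.
Proof.
split=> [qP|]; last exact: positive_definite_expr_colour_length.
apply/andP; split; last first.
  have s01 : (1%g : finperm) != adj_transp 0.
    by apply/eqP => /(congr1 (fun w : finperm => w 0%N)).
  have := @positive_definite_seq _ _ _ [:: 1%g; adj_transp 0]
    (fun w => if w == 1%g then 1 else - 1) qP.
  rewrite /= inE s01 => /(_ isT).
  rewrite !big_cons !big_nil eqxx eq_sym (negbTE s01).
  have sV : (adj_transp 0)^-1%g = adj_transp 0.
    have ss : (adj_transp 0 * adj_transp 0)%g = 1%g.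
      by apply: finpermP => k; exact: adj_swapK.
    by rewrite -[LHS]mulg1 -ss mulKg.
  rewrite !mulVg sV !mulg1 invg1 mul1g colour_length1 colour_length_adj.
  rewrite expr0 expr1 !rmorphN !rmorph1.
  rewrite [X in 0 <= X -> _](_ : _ = (2 - 2 * q)%:C); last first.
    by rewrite rmorphB rmorphM /= rmorph_nat; ring.
  by rewrite ler0c; lra.
(* An even [N] makes [q ^+ N] positive, while the sum over S_N is negative. *)
rewrite leNgt; apply/negP => q0.
have [|N NP] := @unbroken_sum_lt0 R q^-1; first by rewrite invr_lt0.
have := sum_expr_colour_length_ge0 N.+1.*2 qP.
rewrite sum_expr_colour_length ?lt_eqF // leNgt pmulr_rlt0.
  by rewrite doubleS NP // -addnn; lia.
by rewrite exprn_even_gt0 //= ?odd_double // lt_eqF.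
Qed.
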